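(* Let $\mathcal{A}$ be a partial combinatory algebra, $S$ a set, and $\gamma\colon\mathcal{A}\to S$ a precomplete generalized numbering. Then there exists a total element $f\in\mathcal{A}$ such that for all $g\in\mathcal{A}$, if $g(fg)$ is defined then $g(fg)\sim_\gamma fg$.
   Context: A partial applicative structure (pas) is a set $\mathcal{A}$ together with a partial map $\mathcal{A}\times\mathcal{A}\to\mathcal{A}$, written $(a,b)\mapsto ab$ and called application; application associates to the left, so $abc$ means $(ab)c$. Write $t\downarrow$ if $t$ is defined. Terms over $\mathcal{A}$ are built from elements of $\mathcal{A}$, variables, and application; $t(a_1,\ldots,a_n)$ denotes the result of substituting $a_i\in\mathcal{A}$ for the variables $x_i$. Application is strict: for closed terms, $t_1t_2\downarrow$ requires $t_1\downarrow$ and $t_2\downarrow$. For closed terms, $t\simeq s$ means that either both are undefined, or both are defined and equal. An element $f\in\mathcal{A}$ is total if $fa\downarrow$ for every $a\in\mathcal{A}$. A pas $\mathcal{A}$ is a partial combinatory algebra (pca) if it is combinatory complete: for every $n\geq 0$ and every term $t(x_1,\ldots,x_n,x)$ with free variables among $x_1,\ldots,x_n,x$ there exists $b\in\mathcal{A}$ such that for all $a_1,\ldots,a_n,a\in\mathcal{A}$: (i) $ba_1\cdots a_n\downarrow$, and (ii) $ba_1\cdots a_na\simeq t(a_1,\ldots,a_n,a)$. A generalized numbering is a surjection $\gamma\colon\mathcal{A}\to S$, where $\mathcal{A}$ is a pca and $S$ is a set; write $a\sim_\gamma b$ if $\gamma(a)=\gamma(b)$. It is precomplete if for every term $t(x)$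 over $\mathcal{A}$ with one variable $x$ there exists a total element $f\in\mathcal{A}$ such that for every $a\in\mathcal{A}$: if $t(a)\downarrow$ then $fa\sim_\gamma t(a)$. *)

(* Defs.v *)
From mathcomp Require Import all_boot.

Set Implicit Arguments.
Unset Strict Implicit.
Unset Printing Implicit Defensive.

(* [app a b = None] means that the application [a b] is undefined. *)
Record pas := Pas {
  carrier :> Type;
  app : carrier -> carrier -> option carrier }.

(* Terms over [A] with variables among x_0, ..., x_(n-1). *)
Inductive term (A : Type) (n : nat) : Type :=
  | Cst of A
  | Var of 'I_n
  | App of term A n & term A n.

Arguments Cst {A n}.
Arguments Var {A n}.
Arguments App {A n}.

Notation "t \@ s" := (App t s) (at level 40, left associativity).

Fixpoint subst (A : Type) (n : nat) (t : term A n) (a : n.-tuple A) :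
    term A 0 :=
  match t with
  | Cst c => Cst c
  | Var i => Cst (tnth a i)
  | t1 \@ t2 => subst t1 a \@ subst t2 a
  end.

(* The [Var] branch is unreachable, since 'I_0 is empty. *)
Fixpoint eval (A : pas) (t : term A 0) : option A :=
  match t with
  | Cst c => Some c
  | Var _ => None
  | t1 \@ t2 =>
      match eval t1, eval t2 with
      | Some a, Some b => app a b
      | _, _ => None
      end
  end.

Definition defined (A : pas) (t : term A 0) : Prop :=
  exists a : A, eval t = Some a.

Definition kleene_eq (A : pas) (t s : term A 0) : Prop := eval t = eval s.

Definition total_elt (A : pas) (f : A) : Prop :=
  forall a : A, defined (Cst f \@ Cst a).

(* The term b a_1 ... a_n. *)
Definition apps (A : pas) (b : A) (a : seq A) : term A 0 :=
  foldl (fun t c => t \@ Cst c) (Cst b) a.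

Definition combinatory_complete (A : pas) : Prop :=
  forall (n : nat) (t : term A n.+1), exists b : A,
  forall (a : n.-tuple A) (x : A),
    defined (apps b a) /\
    kleene_eq (apps b a \@ Cst x) (subst t [tuple of rcons a x]).

Record pca := Pca {
  pca_pas :> pas;
  pca_complete : combinatory_complete pca_pas }.

Record gen_numbering (A : pca) (S : Type) := GenNumbering {
  gnum :> A -> S;
  gnum_surj : forall s : S, exists a : A, gnum a = s }.

(* The relation a ~ b, extended to closed terms: both are defined and their
   values have the same image. *)
Definition gequiv (A : pca) (S : Type) (gamma : gen_numbering A S)
    (t s : term A 0) : Prop :=
  exists a b : A, [/\ eval t = Some a, eval s = Some b & gamma a = gamma b].

Definition precomplete (A : pca) (S : Type) (gamma : gen_numbering A S) : Prop :=
  forall t : term A 1, exists f : A, total_elt f /\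
  forall a : A, defined (subst t [tuple a]) ->
    gequiv gamma (Cst f \@ Cst a) (subst t [tuple a]).

(* Main.v *)
(** As in Kleene's recursion theorem: precompleteness gives a total [u] with
    [u x ~ x x] whenever [x x] is defined.  Completeness gives [b] such that
    [b z g] is always defined and [b z g y = g (z z g)], and [e] with
    [e z g = u (b z g)].  Then [f = e e] works: [f g = u (b e g)] is defined
    because [u] is total, and it is equivalent to
    [b e g (b e g) = g (e e g) = g (f g)]. *)
Require Import Defs.
From mathcomp Require Import all_boot.

Theorem theorem6p5 (A : pca) (S : Type) (gamma : gen_numbering A S)
    (hgamma : precomplete gamma) :
  exists f : A, total_elt f /\
  forall g : A, defined (Cst g \@ (Cst f \@ Cst g)) ->
    gequiv gamma (Cst g \@ (Cst f \@ Cst g)) (Cst f \@ Cst g).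
Proof.
have [u [u_total uP]] := hgamma (Var ord0 \@ Var ord0).
pose v3 k (h : k < 3) : term A 3 := Var (Ordinal h).
pose v2 k (h : k < 2) : term A 2 := Var (Ordinal h).
(* The third variable does not occur in the term. It only delays evaluation, so that [b z g] is
   defined even when [g (z z g)] is not. *)
have [b bP] := pca_complete
  (v3 1 isT \@ (v3 0 isT \@ v3 0 isT \@ v3 1 isT)).
have [e eP] := pca_complete
  (Cst u \@ (Cst b \@ v2 0 isT \@ v2 1 isT)).
(* Only the definedness of [e e] is kept, so the last argument is arbitrary. *)
have [[f ef] _] := eP [tuple e] e.
have fE g w : eval (apps b [:: e; g]) = Some w -> app f g = app u w.
  move=> bw; have [_] := eP [tuple e] g.
  rewrite /kleene_eq /= in ef bw *.
  by rewrite !(tnth_nth e) /= ef bw.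
(* In both goals [w] is the value of [b e g] and [p] that of [u w]. *)
exists f; split=> [g|g [r gfg]];
  have [[w bw] bE] := bP [tuple e; g] g; have [p up] := u_total w.
  by exists p; rewrite /= (fE g w bw).
have fg : app f g = Some p by rewrite (fE g w bw).
(* The dummy argument of [b] is now [w] itself, which puts [w w] in the domain where [uP]
   applies. *)
have ww : app w w = Some r.
  have [_] := bP [tuple e; g] w.
  rewrite /kleene_eq /= in ef bw gfg *.
  by rewrite !(tnth_nth e) /= bw ef fg => ->; rewrite fg in gfg.
have [|p' [r' [up' ww' gpr]]] := uP w; first by exists r.
exists r, p; split=> //.
move: up up' ww'; rewrite /= !(tnth_nth e) /= ww => -> [->] [->].
by rewrite gpr.
Qed.
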